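(* Let $1<p<\infty$. Then the natural embedding $I:\ell_p\hookrightarrow \ell_{p,\infty}$, $I(u)=u$, is strictly singular.
   Context: All sequences are sequences of real numbers indexed by $\mathbb{N}=\{1,2,\dots\}$. For $a=(a(1),a(2),\dots)\in c_0$ and $\lambda\ge 0$ let $\mu_a(\lambda)=\#\{i: |a(i)|>\lambda\}$ (possibly $\infty$ for $\lambda=0$), and let the non-increasing rearrangement $a^*=(a^*(1),a^*(2),\dots)$ be defined by $a^*(j)=\min\{\lambda\ge 0:\mu_a(\lambda)\le j-1\}$, so that $a^*(1)$ is the largest value of $|a(i)|$. For $1<p<\infty$ put $\|u\|_p=\big(\sum_{j=1}^\infty (u^*(j))^p\big)^{1/p}=\big(\sum_{j=1}^\infty |u(j)|^p\big)^{1/p}$ and $\|u\|_{p,\infty}=\sup_{j\ge 1} j^{1/p}u^*(j)$. The Lebesgue space $\ell_p$ and the weak Lebesgue space $\ell_{p,\infty}$ consist of all sequences $u$ for which $\|u\|_p<\infty$, respectively $\|u\|_{p,\infty}<\infty$. The functional $\|\cdot\|_{p,\infty}$ is in general only a quasi-norm, but for $1<p<\infty$ it is equivalent to a norm on $\ell_{p,\infty}$ under which $\ell_{p,\infty}$ is a Banach space; $\ell_{p,\infty}$ is regarded as a Banach space with such an equivalent norm (the notion of strict singularity does not depend on the choice of equivalent norm). One has $\ell_p\subset\ell_{p,\infty}$ with bounded inclusion. A bounded linear operator $T:X\to Y$ between Banach spaces is strictly singular if there is no infinite-dimensional closed subspace $Z\subset X$ such that the restriction $T:Z\to T(Z)$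 is an isomorphism. Equivalently, $\inf\{\|Tx\|_Y: x\in Z,\ \|x\|_X=1\}=0$ for each infinite-dimensional subspace $Z\subset X$. *)

(* Defs.v *)
From HB Require Import structures.
From mathcomp Require Import all_boot all_order all_algebra.
From mathcomp Require Import finmap ring lra.
From mathcomp Require Import all_classical all_reals all_analysis.

Set Implicit Arguments.
Unset Strict Implicit.
Unset Printing Implicit Defensive.

Import Order.TTheory GRing.Theory Num.Theory.
Import numFieldNormedType.Exports.

Local Open Scope classical_set_scope.
Local Open Scope ring_scope.

Section StrictSingularity.
Context {R : realType}.

Definition finite_dimensional {V : lmodType R} (Z : set V) : Prop :=
  exists (n : nat) (e : 'I_n -> V),
    Z = [set \sum_(i < n) c i *: e i | c in [set: 'I_n -> R]].

(* [T] restricts to a linear homeomorphism from [Z] onto [T @` Z]; the inverse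
   [S] is automatically linear on [T @` Z], and irrelevant elsewhere. *)
Definition isomorphic_on {X Y : normedModType R} (T : X -> Y) (Z : set X) : Prop :=
  {within Z, continuous T} /\
  exists S : Y -> X, {in Z, cancel T S} /\ {within T @` Z, continuous S}.

Definition strictly_singular {X Y : completeNormedModType R}
    (T : {linear X -> Y}) : Prop :=
  continuous T /\
  forall Z : set X, submod_closed (mem Z) -> closed Z ->
    ~ finite_dimensional Z -> ~ isomorphic_on T Z.

End StrictSingularity.

Section Rearrangement.
Context {R : realType}.
Implicit Types (p : R) (a u : nat -> R).

Definition distribution a (l : R) : \bar R := counting [set i | l < `|a i|].

(* Sequences are indexed from 0, so that [rearrangement a j] is a^*(j+1). The
   infimum is attained when [a] tends to 0; in general it is taken in [\bar R],
   and if [a] does not tend to 0 then [weak_norm p a = +oo] for every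
   [0 < p]. *)
Definition rearrangement a (j : nat) : \bar R :=
  ereal_inf [set l%:E | l in [set l | 0 <= l /\ (distribution a l <= j%:R%:E)%E]].

Definition weak_norm p u : \bar R :=
  ereal_sup [set ((j.+1%:R `^ p^-1)%:E * rearrangement u j)%E | j in [set: nat]].

End Rearrangement.

Section Auxiliary.
Context {R : realType}.
Implicit Types (p : R) (u v : nat -> R).

(* A space of sequences is complete as soon as its norm controls the
   coordinates and its balls are, up to a constant, the sequences satisfying
   pointwise closed conditions [phi t _ <= r]. *)
Lemma sequence_space_complete (X : normedModType R) (ev : X -> nat -> R)
    (T : Type) (phi : T -> (nat -> R) -> R) (M K : R) :
  injective ev ->
  (forall x y, ev (x + y) = ev x + ev y) ->
  (forall x i, `|ev x i| <= K * `|x|) ->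
  (forall t x, phi t (ev x) <= `|x|) ->
  (forall r a, (forall t, phi t a <= r) -> 0 <= r ->
     exists x, ev x = a /\ `|x| <= M * r) ->
  (forall t (F : set_system X) (f : X -> nat -> R) (a : nat -> R),
     ProperFilter F -> (forall i, f x i @[x --> F] --> a i) ->
     phi t (f x) @[x --> F] --> phi t a) ->
  forall F : set_system X, ProperFilter F -> cauchy F -> cvg F.
Proof.
move=> ev_inj evD evK phi_le phi_ge phi_cvg F FF /cauchyP Fc.
have ev0 : ev 0 = 0 by apply: (@addIr _ (ev 0)); rewrite -evD !add0r.
have evN x : ev (- x) = - ev x.
  by apply: (@addIr _ (ev x)); rewrite -evD !addNr.
have evB x y : ev (x - y) = ev x - ev y by rewrite evD evN.
pose K' := `|K| + 1.
have K'0 : 0 < K' by rewrite /K' ltr_wpDl.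
have coord i : exists l : R, ev x i @[x --> F] --> l.
  apply/cvg_ex; apply: R_complete; apply/cauchyP => e e0.
  have [x Fx] := Fc _ (divr_gt0 e0 K'0).
  exists (ev x i).
  change (F [set y | ball (ev x i) e (ev y i)]).
  apply: filterS Fx => y.
  rewrite -!ball_normE /= => xyb.
  have -> : ev x i - ev y i = ev (x - y) i by rewrite evB.
  rewrite (le_lt_trans (evK _ _))//.
  rewrite (@le_lt_trans _ _ (K' * `|x - y|))//.
    by rewrite ler_wpM2r// /K' (le_trans (ler_norm _))// lerDl.
  by rewrite mulrC -ltr_pdivlMr.
have [a Fa] := choice coord.
have near_ball (e : R) : 0 < e -> exists x w : X, [/\ F (ball x e),
    ev w = a - ev x & `|w| <= M * e].
  move=> e0.
  have [x Fx] := Fc _ e0.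
  exists x.
  have [t|//|w [ew wM]] := phi_ge e (a - ev x); first 2 last.
    by exists w.
  - have c : phi t (ev (y - x)) @[y --> F] --> phi t (a - ev x).
      apply: (@phi_cvg t F (fun y => ev (y - x))) => i.
      under eq_fun do rewrite evB.
      by apply: cvgB; [exact: Fa|exact: cvg_cst].
    apply: (closed_cvg (fun z => z <= e) (@closed_le _ _) _ _ c).
    near=> y; apply: le_trans (phi_le _ _) _.
    have : ball x e y by near: y.
    by rewrite -ball_normE /= distrC => /ltW.
  - exact: ltW.
have [x0 [w0 [_ ew0 _]]] := near_ball 1 ltr01.
pose u0 := w0 + x0.
have eu0 : ev u0 = a by rewrite evD ew0 subrK.
apply/cvg_ex; exists u0; apply/cvgrPdist_lt => e e0.
pose M' := `|M| + 1.
have M'0 : 0 < M' by rewrite /M' ltr_wpDl.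
have [x [w [Fx ew wM]]] := near_ball (e / (M' + 1)) (divr_gt0 e0 (addr_gt0 M'0 ltr01)).
have -> : u0 = w + x by apply: ev_inj; rewrite eu0 evD ew subrK.
near=> y.
have : ball x (e / (M' + 1)) y by near: y.
rewrite -ball_normE /= => xy.
rewrite -addrA (le_lt_trans (ler_normD _ _))//.
have : `|w| <= M' * (e / (M' + 1)).
  apply: le_trans wM _; apply: ler_wpM2r.
    by rewrite ltW// divr_gt0// addr_gt0.
  by rewrite /M' (le_trans (ler_norm _))// lerDl.
have : M' * (e / (M' + 1)) + e / (M' + 1) = e.
  by rewrite -[X in _ + X]mul1r -mulrDl mulrC divfK// lt0r_neq0// addr_gt0.
by move=> sE wle; rewrite -[ltRHS]sE; exact: ler_ltD.
Unshelve. all: by end_near. Qed.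

Lemma powR_bernoulli (t h : R) : 0 <= t <= 1 -> 0 < h < 1 ->
  (1 - t) `^ h <= 1 - h * t.
Proof.
move=> /andP[t0 t1] /andP[h0 h1].
have t1' : 0 <= 1 - t by rewrite subr_ge0.
have := @conjugate_powR _ ((1 - t) `^ h) 1 h^-1 (1 - h)^-1 (powR_ge0 _ _) ler01.
rewrite !invr_gt0 subr_gt0 !invrK => /(_ h0 h1).
rewrite -powRrM mulfV ?gt_eqF// powRr1// powR1 !mulr1.
by rewrite (addrC h) subrK => /(_ erefl) /le_trans; apply; lra.
Qed.

Lemma powR_succ (h : R) n : 0 < h < 1 ->
  h^-1 * n%:R `^ h + n.+1%:R `^ (h - 1) <= h^-1 * n.+1%:R `^ h.
Proof.
move=> h01; have /andP[h0 h1] := h01.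
have n0 : 0 < n.+1%:R :> R by rewrite ltr0n.
have -> : n%:R = n.+1%:R * (1 - n.+1%:R^-1) :> R.
  by rewrite mulrBr mulfV ?gt_eqF// mulr1 -natr1 addrK.
have i1 : n.+1%:R^-1 <= 1 :> R by rewrite invf_le1// ler1n.
rewrite powRM ?subr_ge0 ?ler0n// powRB ?(gt_eqF n0) ?implybT// powRr1 ?ler0n//.
rewrite mulrCA -mulrDr mulrC ler_wpM2r ?powR_ge0//.
rewrite mulrC.
have := @powR_bernoulli (n.+1%:R^-1) h.
rewrite invr_ge0 ler0n i1 => /(_ isT h01) B.
rewrite -(@ler_pM2l _ h)// mulrDr !mulrA (mulrAC h) !mulfV ?gt_eqF// mul1r.
by rewrite -lerBrDr.
Qed.

Lemma normr_powR_continuous p : 0 < p -> continuous (fun x : R => `|x| `^ p).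
Proof.
move=> p0 x.
have [->|x0] := eqVneq x 0.
  rewrite /continuous_at normr0 powR0 ?gt_eqF//.
  apply/cvgrPdist_lt => e e0; near=> z.
  rewrite sub0r normrN ger0_norm ?powR_ge0//.
  have ze : `|z| < e `^ p^-1.
    by near: z; have := @nbhs0_lt _ R^o (e `^ p^-1) (powR_gt0 _ e0); exact.
  have := @gt0_ltr_powR _ _ p0 _ _ _ _ ze.
  rewrite !nnegrE normr_ge0 powR_ge0 -powRrM mulVf ?gt_eqF// powRr1 ?ltW//.
  exact.
apply: (@cvg_comp _ _ _ (fun x : R => `|x|) (fun y : R => y `^ p) _ (nbhs `|x|)).
  exact: norm_continuous.
have : {for `|x|, continuous (fun y : R => y `^ p)}; last exact.
apply: differentiable_continuous.
apply/derivable1_diffP; apply: derivable_powR.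
by rewrite in_itv/= andbT normr_gt0.
Unshelve. all: by end_near. Qed.

Lemma ler_powRV p (x y : R) : 0 < p -> 0 <= x -> 0 <= y ->
  (x `^ p^-1 <= y) = (x <= y `^ p).
Proof.
move=> p0 x0 y0; have p'0 : 0 < p^-1 by rewrite invr_gt0.
apply/idP/idP => h.
  have := @ge0_ler_powR _ _ (ltW p0) _ _ _ _ h.
  by rewrite !nnegrE powR_ge0 -powRrM mulVf ?gt_eqF// powRr1//; exact.
have := @ge0_ler_powR _ _ (ltW p'0) _ _ _ _ h.
by rewrite !nnegrE powR_ge0 -powRrM mulfV ?gt_eqF// powRr1//; exact.
Qed.

Lemma counting_le_size (X : set nat) n (s : seq nat) :
  (counting X <= n%:R%:E :> \bar R)%E -> uniq s -> {in s, forall i, X i} ->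
  (size s <= n)%N.
Proof.
rewrite /counting; case: asboolP => [Xfin|_]; last by rewrite leye_eq.
rewrite lee_fin ler_nat => Xn us sX; apply: leq_trans Xn.
apply: uniq_leq_size => // i /sX Xi.
by rewrite in_fset_set// inE.
Qed.

Lemma counting_gt_size (X : set nat) n :
  ~~ (counting X <= n%:R%:E :> \bar R)%E ->
  exists s : seq nat, [/\ uniq s, size s = n.+1 & {in s, forall i, X i}].
Proof.
have take_fset (B : {fset nat}) : [set` B] `<=` X -> (n < #|` B|)%N ->
    exists s : seq nat, [/\ uniq s, size s = n.+1 & {in s, forall i, X i}].
  move=> BX nB; exists (take n.+1 B); split.
  - exact/take_uniq/fset_uniq.
  - by rewrite size_takel.
  - by move=> i /mem_take iB; exact: BX.
rewrite /counting; case: asboolP => [Xfin|Xinf _].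
  rewrite lee_fin ler_nat -ltnNge; apply: take_fset.
  by move=> i /=; rewrite in_fset_set// inE.
by have [B] := infinite_set_fset n.+1 Xinf; exact: take_fset.
Qed.

Lemma seq_argmin (f : nat -> R) (s : seq nat) :
  s != [::] -> exists2 k, k \in s & {in s, forall i, f k <= f i}.
Proof.
elim: s => // i [_ _|j s IH _].
  by exists i; rewrite ?inE// => k; rewrite inE => /eqP ->.
have [//|k ks fk] := IH.
have [ik|ki] := leP (f i) (f k).
  exists i; rewrite ?inE ?eqxx// => l; rewrite inE => /predU1P[->//|/fk].
  exact: le_trans.
exists k; rewrite ?(inE, ks) ?orbT// => l; rewrite inE => /predU1P[->|/fk//].
exact: ltW.
Qed.

End Auxiliary.

Section WeakNorm.
Context {R : realType}.
Implicit Types (p : R) (a u v : nat -> R).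

Lemma rearrangement_ge0 a j : (0 <= rearrangement a j)%E.
Proof. by apply: le_ereal_inf_tmp => _ [l [l0 _] <-]; rewrite lee_fin. Qed.

Lemma weak_norm_ge0 p u : (0 <= weak_norm p u)%E.
Proof.
apply: (@le_trans _ _ ((1%:R `^ p^-1)%:E * rearrangement u 0)%E).
  by rewrite mule_ge0 ?rearrangement_ge0// lee_fin powR_ge0.
by apply: ereal_sup_ubound; exists 0%N.
Qed.

Lemma weak_norm_leP p u (C : R) : 0 < p ->
  (weak_norm p u <= C%:E)%E <->
  forall (s : seq nat) (l : R), uniq s -> {in s, forall i, l <= `|u i|} ->
    (size s)%:R `^ p^-1 * l <= C.
Proof.
move=> p0; split=> [uC s l us sl|H].
  have C0 : 0 <= C by rewrite -lee_fin (le_trans (weak_norm_ge0 p u)).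
  have [l0|l0] := leP l 0.
    by rewrite (le_trans _ C0)// mulr_ge0_le0// powR_ge0.
  case: s us sl => [|i0 s] us sl.
    by rewrite powR0 ?mul0r// invr_neq0// gt_eqF.
  have : (((size s).+1%:R `^ p^-1)%:E * l%:E <= C%:E)%E; last by rewrite lee_fin.
  apply: le_trans uC; apply: (@le_trans _ _
    (((size s).+1%:R `^ p^-1)%:E * rearrangement u (size s))%E); last first.
    by apply: ereal_sup_ubound; exists (size s).
  apply: lee_wpmul2l; first by rewrite lee_fin powR_ge0.
  apply: le_ereal_inf_tmp => _ [k [k0 uk] <-]; rewrite lee_fin leNgt.
  apply/negP => kl; have := counting_le_size uk us; rewrite /= ltnn => abs.
  suff : false by [].
  by apply: abs => i /sl /(lt_le_trans kl).
apply: ge_ereal_sup => _ [j _ <-].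
have C0 : 0 <= C.
  by have := H [::] 0 isT; rewrite mulr0; apply => i; rewrite in_nil.
have j0 : 0 < j.+1%:R `^ p^-1 :> R by rewrite powR_gt0.
pose l0 := C / j.+1%:R `^ p^-1.
have [le_l0|] := boolP (distribution u l0 <= j%:R%:E)%E.
  apply: (@le_trans _ _ ((j.+1%:R `^ p^-1)%:E * l0%:E)%E); last first.
    by rewrite lee_fin /l0 mulrC divfK// gt_eqF.
  apply: lee_wpmul2l; first by rewrite lee_fin powR_ge0.
  apply: ereal_inf_lbound; exists l0 => //; split=> //.
  by rewrite divr_ge0// ltW.
move=> /counting_gt_size[s [us szs sX]].
have [l ll sl] : exists2 l, l0 < l & {in s, forall i, l <= `|u i|}.
  elim: s {us szs} sX => [_|i s IH sX]; first by exists (l0 + 1); rewrite ?ltrDl.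
  have [|l ll sl] := IH; first by move=> k ks; apply: sX; rewrite inE ks orbT.
  exists (Order.min l `|u i|).
    by rewrite lt_min ll/=; apply: sX; rewrite inE eqxx.
  move=> k; rewrite inE => /predU1P[->|/sl]; first by rewrite ge_min lexx orbT.
  by rewrite ge_min => ->.
have := H _ _ us sl; rewrite szs -ler_pdivlMl// mulrC => /(lt_le_trans ll).
by rewrite ltxx.
Qed.

(* The averaging functionals below define, for 1 < p, a norm that is
   equivalent to the weak quasi-norm. *)
Definition average p (s : seq nat) u : R :=
  (size s)%:R `^ (p^-1 - 1) * \sum_(i <- s) `|u i|.

Lemma average_ge0 p s u : 0 <= average p s u.
Proof. by rewrite mulr_ge0 ?powR_ge0// sumr_ge0. Qed.

Lemma averageD p s u v : average p s (u + v) <= average p s u + average p s v.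
Proof.
rewrite -mulrDr ler_wpM2l ?powR_ge0// -big_split/= ler_sum// => i _.
exact: ler_normD.
Qed.

Lemma averageZ p s (c : R) u : average p s (c *: u) = `|c| * average p s u.
Proof.
rewrite /average mulrCA; congr (_ * _); rewrite mulr_sumr.
by apply: eq_bigr => i _; rewrite -normrM.
Qed.

Lemma weak_norm_le_average p u (C : R) : 1 < p ->
  (forall s, uniq s -> average p s u <= C) -> (weak_norm p u <= C%:E)%E.
Proof.
move=> p1 H; have p0 : 0 < p by exact: lt_trans ltr01 p1.
apply/weak_norm_leP => // s l us sl.
apply: le_trans (H s us).
have [->|s0] := eqVneq s [::].
  by rewrite powR0 ?mul0r ?average_ge0// invr_neq0// gt_eqF.
have n0 : (size s)%:R != 0 :> R by rewrite pnatr_eq0 size_eq0.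
have -> : (size s)%:R `^ p^-1 * l = (size s)%:R `^ (p^-1 - 1) * ((size s)%:R * l).
  by rewrite powRB ?n0 ?implybT// powRr1// mulrA divfK.
rewrite ler_wpM2l ?powR_ge0//.
have -> : (size s)%:R * l = \sum_(i <- s) l.
  by rewrite big_const_seq count_predT iter_addr addr0 mulr_natl.
by rewrite big_seq [leRHS]big_seq; exact: ler_sum.
Qed.

Lemma average_le_weak_norm p u (C : R) (s : seq nat) : 1 < p ->
  (weak_norm p u <= C%:E)%E -> uniq s -> average p s u <= (1 - p^-1)^-1 * C.
Proof.
move=> p1 uC us; have p0 : 0 < p by exact: lt_trans ltr01 p1.
have C0 : 0 <= C by rewrite -lee_fin (le_trans (weak_norm_ge0 p u)).
set h := 1 - p^-1.
have h01 : 0 < h < 1.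
  by rewrite /h subr_gt0 invf_lt1// p1/= ltrBlDr ltrDl invr_gt0.
have /andP[h0 h1] := h01.
have /(_ _ _ us) le_sum : forall (n : nat) (s : seq nat), uniq s -> size s = n ->
    \sum_(i <- s) `|u i| <= C * (h^-1 * n%:R `^ h).
  elim=> [|n IH] {us}s us szs.
    by rewrite (size0nil szs) big_nil mulr_ge0// mulr_ge0 ?powR_ge0// invr_ge0 ltW.
  have [|k ks uk] := @seq_argmin R (fun i => `|u i|) s; first by case: s szs {us}.
  have := (weak_norm_leP u C p0).1 uC s _ us uk; rewrite szs => kC.
  rewrite (big_rem k)//= addrC.
  apply: (@le_trans _ _ (C * (h^-1 * n%:R `^ h) + C * n.+1%:R `^ (h - 1))).
    apply: lerD; first by rewrite IH ?rem_uniq// size_rem// szs.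
    rewrite /h addrAC subrr add0r powRN mulrC.
    by rewrite ler_pdivlMl ?powR_gt0// .
  by rewrite -mulrDr ler_wpM2l// powR_succ.
rewrite /average -/h.
have -> : p^-1 - 1 = - h by rewrite /h opprB.
apply: le_trans (_ : (size s)%:R `^ (- h) * (C * (h^-1 * (size s)%:R `^ h)) <= _).
  by rewrite ler_wpM2l ?powR_ge0// le_sum.
rewrite powRN; set x := (size s)%:R `^ h.
have -> : x^-1 * (C * (h^-1 * x)) = h^-1 * C * (x^-1 * x) by ring.
rewrite ler_piMr//; first by rewrite mulr_ge0// invr_ge0 ltW.
have [->|n0] := eqVneq x 0; first by rewrite mulr0.
by rewrite mulVf.
Qed.

Lemma weak_norm_fin p u : 1 < p -> (weak_norm p u < +oo)%E <->
  exists C, forall s, uniq s -> average p s u <= C.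
Proof.
move=> p1; split=> [uoo|[C uC]].
  exists ((1 - p^-1)^-1 * fine (weak_norm p u)) => s us.
  apply: average_le_weak_norm => //; rewrite fineK// ge0_fin_numE//.
  exact: weak_norm_ge0.
by apply: le_lt_trans (ltry C); exact: weak_norm_le_average.
Qed.

End WeakNorm.

Section LebesgueSpace.
Context {R : realType} {p : R}.

Lemma expo_ge1 (p_gt1 : 1 < p) : (1 <= p%:E)%E.
Proof. by rewrite lee_fin ltW. Qed.

(* Over [nat], measurability is no restriction, and by [Lnorm_counting] the norm
   below is (\sum_k |u k|^p)^(1/p). *)
Definition ell (p_gt1 : 1 < p) : Type :=
  LfunType (counting : {measure set nat -> \bar R}) (expo_ge1 p_gt1).

HB.instance Definition _ (p_gt1 : 1 < p) := GRing.Lmodule.on (ell p_gt1).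

Definition ell_val (p_gt1 : 1 < p) (u : ell p_gt1) : nat -> R :=
  (u : LfunType (counting : {measure set nat -> \bar R}) (expo_ge1 p_gt1)).
Coercion ell_val : ell >-> Funclass.

Definition ell_norm (p_gt1 : 1 < p) (u : ell p_gt1) : R :=
  fine 'N[counting]_(p%:E)[EFin \o u]%E.

Lemma Lnorm_counting_leP (u : nat -> R) (C : R) : 0 < p -> 0 <= C ->
  ('N[counting]_(p%:E)[EFin \o u] <= C%:E)%E <->
  forall n, (\sum_(k < n) `|u k| `^ p) `^ p^-1 <= C.
Proof.
move=> p0 C0; have C'0 : (0 <= C%:E)%E by rewrite lee_fin.
have sum0 n : 0 <= \sum_(k < n) `|u k| `^ p.
  by rewrite sumr_ge0// => k _; rewrite powR_ge0.
have -> : ('N[counting]_(p%:E)[EFin \o u] <= C%:E)%E =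
    (\sum_(0 <= k <oo) (`|u k| `^ p)%:E <= (C `^ p)%:E)%E.
  rewrite Lnorm_counting//.
  have S0 : (0 <= \sum_(0 <= k <oo) (`|u k| `^ p)%:E)%E.
    by apply: nneseries_ge0 => k _ _; rewrite lee_fin powR_ge0.
  rewrite [X in (X `^ _)%E](_ : _ = \sum_(0 <= k <oo) (`|u k| `^ p)%:E)%E//.
  case: (\sum_(0 <= k <oo) _)%E S0 => [r r0|_|//].
    by rewrite poweR_EFin !lee_fin ler_powRV.
  by rewrite poweRyr ?invr_neq0 ?gt_eqF// !leye_eq.
split=> [SC n|H].
  rewrite ler_powRV// -lee_fin; apply: le_trans SC.
  rewrite -sumEFin -(big_mkord xpredT (fun k => (`|u k| `^ p)%:E)).
  by apply: nneseries_lim_ge => k _ _; rewrite lee_fin powR_ge0.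
apply: lime_le.
  by apply: is_cvg_nneseries => k _ _; rewrite lee_fin powR_ge0.
apply: nearW => n; rewrite big_mkord sumEFin lee_fin -ler_powRV//.
Qed.

Section Norm.
Context {p_gt1 : 1 < p}.
Implicit Types u v : ell p_gt1.

Let p0 : 0 < p. Proof. exact: lt_trans ltr01 p_gt1. Qed.

Lemma ell_inj : injective (@ell_val p_gt1).
Proof. by move=> u v; exact: val_inj. Qed.

Lemma ell_valD u v : ell_val (u + v) = ell_val u + ell_val v.
Proof. by []. Qed.

Lemma ell_valZ (c : R) u : ell_val (c *: u) = c *: ell_val u.
Proof. by []. Qed.

Lemma ell_normE u : (ell_norm u)%:E = 'N[counting]_(p%:E)[EFin \o u]%E.
Proof. exact: (@finite_norm_fine _ _ _ _ _ (expo_ge1 p_gt1)). Qed.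

Lemma ell_norm_ge0 u : 0 <= ell_norm u.
Proof. by rewrite fine_ge0// Lnorm_ge0. Qed.

Lemma ell_normD u v : ell_norm (u + v) <= ell_norm u + ell_norm v.
Proof. exact: (@ler_LnormD _ _ _ _ _ (expo_ge1 p_gt1)). Qed.

Lemma ell_normZ (c : R) u : ell_norm (c *: u) = `|c| * ell_norm u.
Proof.
apply: EFin_inj; rewrite EFinM !ell_normE.
exact: (@LnormZ _ _ _ _ _ (expo_ge1 p_gt1)).
Qed.

Lemma ell_norm_sum u n : (\sum_(k < n) `|u k| `^ p) `^ p^-1 <= ell_norm u.
Proof.
by apply: (Lnorm_counting_leP u p0 (ell_norm_ge0 u)).1; rewrite ell_normE.
Qed.

Lemma ell_norm_coord u i : `|u i| <= ell_norm u.
Proof.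
apply: le_trans (ell_norm_sum u i.+1).
have sum0 n : 0 <= \sum_(k < n) `|u k| `^ p.
  by rewrite sumr_ge0// => k _; rewrite powR_ge0.
have -> : `|u i| = (`|u i| `^ p) `^ p^-1.
  by rewrite -powRrM mulfV ?gt_eqF// powRr1.
apply: ge0_ler_powR; first by rewrite invr_ge0 ltW.
- by rewrite nnegrE powR_ge0.
- by rewrite nnegrE sum0.
- rewrite big_ord_recr/= lerDr; exact: sum0.
Qed.

Lemma ell_norm0_eq0 u : ell_norm u = 0 -> u = 0.
Proof.
move=> u0; apply: ell_inj; apply/funext => i.
by apply/eqP; rewrite -normr_le0 -u0 ell_norm_coord.
Qed.

HB.instance Definition _ := @Lmodule_isNormed.Build R (ell p_gt1)
  (@ell_norm p_gt1) ell_normD ell_normZ ell_norm0_eq0.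

Lemma ell_of_bounded (r : R) (a : nat -> R) : 0 <= r ->
  (forall n, (\sum_(k < n) `|a k| `^ p) `^ p^-1 <= r) ->
  exists u : ell p_gt1, ell_val u = a /\ `|u| <= r.
Proof.
move=> r0 ar.
have Nar : ('N[counting]_(p%:E)[EFin \o a] <= r%:E)%E.
  exact/Lnorm_counting_leP.
have aL : a \in Lfun (counting : {measure set nat -> \bar R}) p%:E.
  apply/andP; split; first by rewrite inE/= => _ Y _; exact: I.
  by rewrite inE/= /finite_norm (le_lt_trans Nar)// ltry.
exists (Lfun_Sub (expo_ge1 p_gt1) aL); split=> //.
by rewrite -[leLHS]/(ell_norm _) -lee_fin ell_normE.
Qed.

Lemma ell_complete (F : set_system (ell p_gt1)) :
  ProperFilter F -> cauchy F -> cvg F.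
Proof.
apply: (@sequence_space_complete _ _ (@ell_val p_gt1) nat
  (fun n a => (\sum_(k < n) `|a k| `^ p) `^ p^-1) 1 1).
- exact: ell_inj.
- exact: ell_valD.
- by move=> u i; rewrite mul1r; exact: ell_norm_coord.
- by move=> n u; exact: ell_norm_sum.
- by move=> r a ar r0; rewrite mul1r; exact: ell_of_bounded.
- move=> n {}F f a FF Fa.
  have sum_cvg : \sum_(k < n) `|f x k| `^ p @[x --> F] --> \sum_(k < n) `|a k| `^ p.
    apply: cvg_big => [|k _]; first exact: add_continuous.
    apply: (cvg_comp (fun x => f x k) (fun y : R => `|y| `^ p) (Fa k)).
    exact: normr_powR_continuous.
  have nn b : \sum_(k < n) `|b k| `^ p = `|\sum_(k < n) `|b k| `^ p| :> R.
    by rewrite ger0_norm// sumr_ge0// => k _; rewrite powR_ge0.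
  rewrite nn; under eq_fun do rewrite nn.
  apply: (cvg_comp _ (fun y : R => `|y| `^ p^-1) sum_cvg).
  by apply: normr_powR_continuous; rewrite invr_gt0.
Qed.

HB.instance Definition _ := Uniform_isComplete.Build (ell p_gt1) ell_complete.

End Norm.
End LebesgueSpace.

Section WeakLebesgueSpace.
Context {R : realType} {p : R}.

Definition weak_finite (p_gt1 : 1 < p) : {pred nat -> R} :=
  mem [set u | (weak_norm p u < +oo)%E].

Lemma in_weak_finite (p_gt1 : 1 < p) (u : nat -> R) :
  (u \in weak_finite p_gt1) = (weak_norm p u < +oo)%E.
Proof. by apply/idP/idP => [/set_mem|uoo]; [|apply/mem_set]. Qed.

Lemma weak_finite_submod_closed (p_gt1 : 1 < p) :
  submod_closed (weak_finite p_gt1).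
Proof.
split.
  rewrite in_weak_finite; apply/weak_norm_fin => //; exists 0 => s _.
  by rewrite -(scale0r (0 : nat -> R)) averageZ normr0 mul0r.
move=> c u v; rewrite in_weak_finite => /(weak_norm_fin _ p_gt1)[C uC].
rewrite in_weak_finite => /(weak_norm_fin _ p_gt1)[D vD].
rewrite in_weak_finite; apply/weak_norm_fin => //.
exists (`|c| * C + D) => s us; apply: le_trans (averageD _ _ _ _) _.
by rewrite averageZ lerD ?vD// ler_wpM2l ?uC.
Qed.

HB.instance Definition _ (p_gt1 : 1 < p) :=
  GRing.isSubmodClosed.Build R (nat -> R) (weak_finite p_gt1)
    (weak_finite_submod_closed p_gt1).

Record weak_ell (p_gt1 : 1 < p) := WeakEll {
  weak_ell_val :> nat -> R;
  weak_ell_valP : weak_ell_val \in weak_finite p_gt1 }.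

HB.instance Definition _ (p_gt1 : 1 < p) :=
  [isSub for @weak_ell_val p_gt1].
HB.instance Definition _ (p_gt1 : 1 < p) := [Choice of weak_ell p_gt1 by <:].
HB.instance Definition _ (p_gt1 : 1 < p) :=
  [SubChoice_isSubLmodule of weak_ell p_gt1 by <:].

(* Definiteness follows from the lower bound in [enorm_equiv]. *)
Record equivalent_norm (p_gt1 : 1 < p) := EquivalentNorm {
  enorm :> weak_ell p_gt1 -> R;
  enormD : forall u v, enorm (u + v) <= enorm u + enorm v;
  enormZ : forall (c : R) u, enorm (c *: u) = `|c| * enorm u;
  enorm_equiv : exists c C : R, [/\ 0 < c, 0 < C & forall u : weak_ell p_gt1,
    (c%:E * weak_norm p u <= (enorm u)%:E <= C%:E * weak_norm p u)%E] }.

(* The space [weak_ell p_gt1] normed by [N]. *)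
Definition renormed (p_gt1 : 1 < p) (N : equivalent_norm p_gt1) : Type :=
  weak_ell p_gt1.

HB.instance Definition _ (p_gt1 : 1 < p) (N : equivalent_norm p_gt1) :=
  GRing.Lmodule.on (renormed N).

Section Norm.
Context {p_gt1 : 1 < p}.
Implicit Types u v : weak_ell p_gt1.

Let p0 : 0 < p. Proof. exact: lt_trans ltr01 p_gt1. Qed.

Let h : R := 1 - p^-1.

Let h0 : 0 < h. Proof. by rewrite subr_gt0 invf_lt1. Qed.

Lemma weak_normK u : (fine (weak_norm p u))%:E = weak_norm p u.
Proof.
rewrite fineK// ge0_fin_numE ?weak_norm_ge0//.
by rewrite -(in_weak_finite p_gt1) weak_ell_valP.
Qed.

Lemma average1 i (u : nat -> R) : average p [:: i] u = `|u i|.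
Proof. by rewrite /average big_seq1 powR1 mul1r. Qed.

Section EquivalentNorm.
Variable N : equivalent_norm p_gt1.

Lemma average_le_enorm : exists2 k : R, 0 < k &
  forall (s : seq nat) u, uniq s -> k * average p s u <= N u.
Proof.
have [c [C [c0 _ NE]]] := enorm_equiv N.
exists (c * h); first by rewrite mulr_gt0.
move=> s u us; have /andP[+ _] := NE u.
rewrite -weak_normK -EFinM lee_fin; apply: le_trans.
rewrite -mulrA ler_pM2l// -ler_pdivlMl//.
by apply: average_le_weak_norm => //; rewrite weak_normK.
Qed.

Lemma enorm0_eq0 u : N u = 0 -> u = 0.
Proof.
have [k k0 kN] := average_le_enorm.
move=> u0; apply: val_inj; apply/funext => i.
apply/eqP; rewrite -normr_le0 -average1 -(pmulr_rle0 _ k0) -u0.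
exact: kN.
Qed.

HB.instance Definition _ := @Lmodule_isNormed.Build R (renormed N)
  (enorm N) (enormD N) (enormZ N) enorm0_eq0.

Lemma renormed_complete (F : set_system (renormed N)) :
  ProperFilter F -> cauchy F -> cvg F.
Proof.
have [k k0 kN] := average_le_enorm.
have [c [C [c0 C0 NE]]] := enorm_equiv N.
apply: (@sequence_space_complete _ (renormed N) (@weak_ell_val p_gt1)
  {s : seq nat | uniq s} (fun s a => k * average p (sval s) a) (C / k) k^-1).
- exact: val_inj.
- by [].
- by move=> u i; rewrite mulrC ler_pdivlMr// mulrC -average1; exact: kN.
- by move=> [s us] u; exact: kN.
- move=> r a ar r0.
  have wa : (weak_norm p a <= (k^-1 * r)%:E)%E.
    apply: weak_norm_le_average => // s us.
    by rewrite ler_pdivlMl//; exact: (ar (exist _ s us)).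
  have aP : a \in weak_finite p_gt1.
    by rewrite in_weak_finite; apply: le_lt_trans wa (ltry _).
  exists (WeakEll aP); split=> //.
  rewrite -[leLHS]/(N (WeakEll aP)) -lee_fin.
  have /andP[_ /le_trans] := NE (WeakEll aP); apply.
  by rewrite -mulrA EFinM lee_wpmul2l// lee_fin ltW.
- move=> [s us] {}F f a FF Fa /=.
  apply: cvgMr; apply: cvgMr.
  apply: cvg_big => [|i _]; first exact: add_continuous.
  exact: cvg_norm (Fa i).
Qed.

HB.instance Definition _ := Uniform_isComplete.Build (renormed N)
  renormed_complete.

End EquivalentNorm.

Lemma weak_norm_le_ell (u : ell p_gt1) : (weak_norm p u <= `|u|%:E)%E.
Proof.
apply/weak_norm_leP => // s l us sl.
have [l0|l0] := leP l 0.
  by rewrite (le_trans _ (normr_ge0 u))// mulr_ge0_le0// powR_ge0.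
pose n := (\max_(i <- s) i).+1.
apply: le_trans (ell_norm_sum u n).
have -> : l = (l `^ p) `^ p^-1.
  by rewrite -powRrM mulfV ?gt_eqF// powRr1// ltW.
rewrite -powRM ?powR_ge0 ?ler0n//.
have sum_ge : (size s)%:R * l `^ p <= \sum_(k < n) `|u k| `^ p.
  have -> : (size s)%:R * l `^ p = \sum_(i <- s) l `^ p.
    by rewrite big_const_seq count_predT iter_addr addr0 mulr_natl.
  apply: (@le_trans _ _ (\sum_(i <- s) `|u i| `^ p)).
    rewrite big_seq [leRHS]big_seq; apply: ler_sum => i /sl li.
    by apply: ge0_ler_powR; rewrite ?nnegrE// ltW.
  rewrite -(big_mkord xpredT (fun k => `|u k| `^ p)).
  have -> : \sum_(i <- s) `|u i| `^ p = \sum_(0 <= i < n | i \in s) `|u i| `^ p.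
    rewrite -[RHS]big_filter; apply: perm_big; apply: uniq_perm => //.
      by rewrite filter_uniq// iota_uniq.
    move=> i; rewrite mem_filter mem_index_iota /= ltnS.
    by case: (boolP (i \in s)) => //= is_; rewrite leq_bigmax_seq.
  rewrite [leLHS]big_mkcond/=; apply: ler_sum => i _.
  by case: ifP => // _; exact: powR_ge0.
apply: ge0_ler_powR => //; first by rewrite invr_ge0 ltW.
- by rewrite nnegrE mulr_ge0// powR_ge0.
- by rewrite nnegrE sumr_ge0// => k _; exact: powR_ge0.
Qed.

Lemma ell_weak_finite (u : ell p_gt1) : ell_val u \in weak_finite p_gt1.
Proof.
by rewrite in_weak_finite (le_lt_trans (weak_norm_le_ell u))// ltry.
Qed.

Definition embedding (N : equivalent_norm p_gt1) (u : ell p_gt1) : renormed N :=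
  WeakEll (ell_weak_finite u).

Lemma embedding_linear (N : equivalent_norm p_gt1) : linear (embedding N).
Proof. by move=> c u v; exact: val_inj. Qed.

HB.instance Definition _ (N : equivalent_norm p_gt1) :=
  GRing.isLinear.Build R (ell p_gt1) (renormed N) *:%R (embedding N)
    (embedding_linear N).

Definition average_norm (u : weak_ell p_gt1) : R :=
  sup [set average p s u | s in [set s | uniq s]].

Lemma average_has_sup (u : weak_ell p_gt1) :
  has_sup [set average p s u | s in [set s | uniq s]].
Proof.
split; first by exists (average p [::] u), [::].
exists ((1 - p^-1)^-1 * fine (weak_norm p u)) => _ [s us <-].
by apply: average_le_weak_norm => //; rewrite weak_normK.
Qed.

Lemma average_normP (u : weak_ell p_gt1) (C : R) :
  average_norm u <= C <-> forall s, uniq s -> average p s u <= C.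
Proof.
split=> [uC s us|uC].
  by apply: le_trans uC; apply: ub_le_sup; [case: (average_has_sup u)|exists s].
by apply: ge_sup => [|_ [s us <-]]; [case: (average_has_sup u)|exact: uC].
Qed.

Lemma average_normD u v :
  average_norm (u + v) <= average_norm u + average_norm v.
Proof.
apply/average_normP => s us; apply: le_trans (averageD _ _ _ _) _.
by apply: lerD; exact: (average_normP _ _).1.
Qed.

Lemma average_normZ (c : R) u : average_norm (c *: u) = `|c| * average_norm u.
Proof.
have leZ d v : average_norm (d *: v) <= `|d| * average_norm v.
  apply/average_normP => s us.
  rewrite [leLHS](averageZ p s d v) ler_wpM2l//; exact: (average_normP _ _).1.
apply/eqP; rewrite eq_le leZ/=.
have [->|c0] := eqVneq c 0.
  rewrite normr0 mul0r; apply: le_trans (average_ge0 p [::] _) _.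
  exact: (average_normP _ _).1.
rewrite -ler_pdivlMl ?normr_gt0// -normfV.
by apply: le_trans (leZ _ _); rewrite scalerA mulVf// scale1r.
Qed.

Lemma average_norm_equiv : exists c C : R, [/\ 0 < c, 0 < C &
  forall u : weak_ell p_gt1,
    (c%:E * weak_norm p u <= (average_norm u)%:E <= C%:E * weak_norm p u)%E].
Proof.
exists 1, h^-1; split; rewrite ?invr_gt0// => u; apply/andP; split.
  rewrite mul1e; apply: weak_norm_le_average => // s us.
  exact: (average_normP _ _).1.
rewrite -weak_normK -EFinM lee_fin; apply/average_normP => s us.
by apply: average_le_weak_norm => //; rewrite weak_normK.
Qed.

Lemma equivalent_norm_inhabited : inhabited (equivalent_norm p_gt1).
Proof.
by split; exact: (EquivalentNorm average_normD average_normZ average_norm_equiv).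
Qed.

End Norm.
End WeakLebesgueSpace.

(* Main.v *)
Require Import Defs.
From mathcomp Require Import all_boot all_order all_algebra.
From mathcomp Require Import all_classical all_reals all_analysis.
From mathcomp Require Import lra.

(** An infinite-dimensional closed subspace [Z] of [ell_p] contains vectors of
    arbitrarily large [ell_p] norm and bounded weak quasi-norm, so the inclusion
    is not bounded below on [Z]. Such vectors are sums of humps
    [y_1 + ... + y_n] with [y_k] in [Z] of norm 1 and almost disjoint supports:
    the [p]-th power of the [ell_p] norm then grows linearly in [n]
    ([gliding_hump]). Humps starting beyond any given index exist because
    finitely many coordinates cannot separate the points of [Z]
    ([exists_unit_vanishing_below]).

    The weak quasi-norm stays bounded if in addition the humps become flatter
    and flatter. Call [l ^ p * #{i : |v i| >= l}] the contribution of the level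
    [l]. Given a partial sum [v], there is a threshold [e] such that adding a
    hump whose coordinates, and those of [v] where the hump lives, are small
    compared to [e] does not alter the contributions of the levels above [e].
    For the levels below [e], split the indices at some [m] beyond which [v] has
    norm at most 1: the first [m] coordinates contribute at most 1 if [e] is
    small, and beyond them [v] and the hump both have norm at most 1, so that
    their sum has an absolutely bounded contribution by the Chebyshev
    inequality. The bound is therefore maintained with a constant that does not
    depend on the number of humps ([exists_large_level_bounded]).

    Flat humps come from the same construction, with the weaker requirement that
    the coordinates of the sums be bounded by 2: a sum of [ell_p] norm [r], once
    normalised, has coordinates at most [2 / r]
    ([exists_unit_small_coordinates]). *)

Set Implicit Arguments.
Unset Strict Implicit.
Unset Printing Implicit Defensive.

Import Order.TTheory GRing.Theory Num.Theory.
Import numFieldNormedType.Exports.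

Local Open Scope classical_set_scope.
Local Open Scope ring_scope.

(** * Linear algebra and operators *)

(** One vector of [Z] off the hyperplane completes a spanning family. *)
Lemma finite_dimensional_hyperplane (R : realType) (V : lmodType R)
    (f : V -> R) (Z : set V) : scalar f -> submod_closed (mem Z) ->
  finite_dimensional (Z `&` [set x | f x = 0]) -> finite_dimensional Z.
Proof.
move=> flin [Z0 ZD] [n [e Ze]].
have [Zf|] := pselect (Z `<=` [set x | f x = 0]).
  by exists n, e; rewrite -Ze; apply/esym/setIidPl.
move=> /existsNP[z0 /not_implyP[Zz0 /eqP fz0]].
have ZDP c x y : Z x -> Z y -> Z (c *: x + y).
  by move=> Zx Zy; apply/set_mem/ZD; apply/mem_set.
exists n.+1, (fun i => if unlift ord0 i is Some j then e j else z0).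
apply/seteqP; split=> [z Zz|_ [c _ <-]].
- have : (Z `&` [set x | f x = 0]) (- (f z / f z0) *: z0 + z).
    split; first exact: ZDP.
    by rewrite /= flin mulNr divfK// addNr.
  rewrite Ze => -[c _ cE].
  exists (fun i => if unlift ord0 i is Some j then c j else f z / f z0) => //.
  rewrite big_ord_recl /= unlift_none.
  under eq_bigr do rewrite liftK.
  by rewrite cE scaleNr addNKr.
- rewrite big_ord_recl /= unlift_none; apply: ZDP => //.
  under eq_bigr do rewrite liftK.
  suff : (Z `&` [set x | f x = 0]) (\sum_(i < n) c (lift ord0 i) *: e i).
    by case.
  by rewrite Ze; exists (fun i => c (lift ord0 i)).
Qed.

(** Continuity of the inverse at 0 suffices, by homogeneity: a vector of [Z] is
    rescaled so that its image falls within the radius on which the inverse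
    takes values of norm less than 1. *)
Lemma isomorphic_on_bounded_below (R : realType) (X Y : normedModType R)
    (T : {linear X -> Y}) (Z : set X) : submod_closed (mem Z) ->
  isomorphic_on T Z ->
  exists2 K : R, 0 < K & forall x, Z x -> `|x| <= K * `|T x|.
Proof.
move=> [Z0 ZD] [_ [S [TK Scont]]].
have S0 : S 0 = 0 by rewrite -[X in S X](linear0 T) TK.
have TZ0 : (T @` Z) 0 by exists 0; [exact/set_mem|rewrite linear0].
have /cvgrPdist_lt := (subspace_continuousP _ _).1 Scont 0 TZ0.
move=> /(_ 1 ltr01) /nbhs_norm0P[d /= d0 Sd].
exists (2 / d); first by rewrite divr_gt0.
move=> x Zx; have [->|x0] := eqVneq x 0; first by rewrite linear0 !normr0 mulr0.
have Tx0 : T x != 0.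
  apply: contra_neq x0 => Tx0.
  by rewrite -(TK x) ?Tx0 ?S0//; exact/mem_set.
have nTx0 : 0 < `|T x| by rewrite normr_gt0.
pose c := d / 2 / `|T x|.
have c0 : 0 < c by rewrite !divr_gt0.
have Zcx : Z (c *: x).
  by rewrite -[X in Z X]addr0; apply/set_mem/ZD => //; exact/mem_set.
have := Sd (T (c *: x)).
rewrite /= linearZ /= normrZ (gtr0_norm c0) /c divfK ?gt_eqF// -/c.
have d2 : d / 2 < d by lra.
move=> /(_ d2); rewrite /from_subspace S0 sub0r normrN -linearZ /=.
move=> /(_ (ex_intro2 _ _ (c *: x) Zcx erefl)).
rewrite TK; last exact/mem_set.
rewrite normrZ (gtr0_norm c0) -ltr_pdivlMl// mulr1 => /ltW.
by rewrite /c !invf_div mulrA (mulrC _ 2) mulrAC.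
Qed.

(** * Finite sums of powers *)

Lemma ler_sum_subset (R : realType) (F : nat -> R) (s t : seq nat) :
  (forall i, 0 <= F i) -> uniq s -> uniq t -> {subset s <= t} ->
  \sum_(i <- s) F i <= \sum_(i <- t) F i.
Proof.
move=> F0 us ut st.
rewrite (perm_big [seq i <- t | i \in s]); last first.
  apply: uniq_perm => //; first exact: filter_uniq.
  move=> i; rewrite mem_filter.
  by case: (boolP (i \in s)) => //= /st ->.
rewrite big_filter big_mkcond; apply: ler_sum => i _.
by case: ifP.
Qed.

Lemma uniq_iota_cat (m : nat) (s : seq nat) :
  uniq s -> {in s, forall i, (m <= i)%N} -> uniq (iota 0 m ++ s).
Proof.
move=> us sm; rewrite cat_uniq us iota_uniq andbT/=; apply/hasPn => i /sm.
by rewrite mem_iota add0n leqNgt.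
Qed.

(** A substitute for the Minkowski inequality that holds term by term. *)
Lemma powRD_le (R : realType) (p x y : R) : 0 < p ->
  `|x + y| `^ p <= 2 `^ p * (`|x| `^ p + `|y| `^ p).
Proof.
move=> p0; wlog xy : x y / `|x| <= `|y|.
  move=> H; have [/H//|/ltW/H] := leP `|x| `|y|.
  by rewrite addrC [X in _ * X]addrC.
apply: (@le_trans _ _ ((2 * `|y|) `^ p)).
  apply: ge0_ler_powR; rewrite ?nnegrE ?mulr_ge0//; first exact: ltW.
  by rewrite (le_trans (ler_normD _ _))// mulr2n mulrDl mul1r lerD2r.
by rewrite powRM// ler_wpM2l ?powR_ge0// lerDr powR_ge0.
Qed.

(** The Chebyshev inequality for the counting measure. *)
Lemma level_size_le_sum (R : realType) (p : R) (v : nat -> R) (s : seq nat)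
    (l : R) : 0 < p -> 0 <= l ->
  {in s, forall i, l <= `|v i|} ->
  (size s)%:R * l `^ p <= \sum_(i <- s) `|v i| `^ p.
Proof.
move=> p0 l0 sl; have -> : (size s)%:R * l `^ p = \sum_(i <- s) l `^ p.
  by rewrite big_const_seq count_predT iter_addr addr0 mulr_natl.
rewrite big_seq [leRHS]big_seq; apply: ler_sum => i /sl li.
by apply: ge0_ler_powR; rewrite ?nnegrE// ltW.
Qed.

(** * Subspaces and tails in the sequence space *)

Section SequencesInEll.
Context {R : realType} {p : R} {p_gt1 : 1 < p}.
Implicit Types (u v y : ell p_gt1) (Z : set (ell p_gt1)).

Let p0 : 0 < p. Proof. exact: lt_trans ltr01 p_gt1. Qed.

Definition vanishes_below (m : nat) u := forall i, (i < m)%N -> u i = 0.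

Lemma ell_linE (c : R) u v i : (c *: u + v : ell p_gt1) i = c * u i + v i.
Proof. by []. Qed.

Lemma ellD u v i : (u + v : ell p_gt1) i = u i + v i.
Proof. by []. Qed.

Lemma ellZ (c : R) u i : (c *: u : ell p_gt1) i = c * u i.
Proof. by []. Qed.

(** Each further coordinate cuts out a hyperplane, which cannot turn an
    infinite-dimensional space into a finite-dimensional one. *)
Lemma infinite_dimensional_vanishes_below Z : submod_closed (mem Z) ->
  ~ finite_dimensional Z ->
  forall m, ~ finite_dimensional (Z `&` [set u | vanishes_below m u]).
Proof.
move=> Zsub Zinf; elim=> [|m IH].
  rewrite (_ : _ `&` _ = Z)//; apply/setIidPl => u _ i.
  by rewrite ltn0.
apply: contra_not IH => fdZ.
apply: (@finite_dimensional_hyperplane _ _ (fun u => u m)) => //.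
  have [Z0 ZD] := Zsub; split.
    by apply/mem_set; split; [exact/set_mem|].
  move=> c x y /set_mem[Zx x0] /set_mem[Zy y0]; apply/mem_set; split.
    by apply/set_mem/ZD; apply/mem_set.
  by move=> i im; rewrite ell_linE x0// y0// mulr0 addr0.
rewrite (_ : _ `&` _ `&` _ = Z `&` [set u | vanishes_below m.+1 u])//.
apply/seteqP; split=> u /=.
  move=> [[Zu u0] um]; split=> // i; rewrite ltnS leq_eqVlt.
  by case/predU1P => [->|/u0].
move=> [Zu u0]; split; last exact: u0.
by split=> // i im; apply: u0; exact: ltnW.
Qed.

Lemma normalizeZ Z u : submod_closed (mem Z) -> Z u -> u != 0 ->
  Z (`|u|^-1 *: u) /\ `| `|u|^-1 *: u| = 1.
Proof.
move=> [Z0 ZD] Zu u0; split.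
  rewrite -[X in Z X]addr0; apply/set_mem/ZD => //.
  exact/mem_set.
by rewrite normrZ normfV normr_id mulVf// normr_eq0.
Qed.

Lemma exists_unit_vanishing_below Z : submod_closed (mem Z) ->
  ~ finite_dimensional Z ->
  forall m, exists y, [/\ Z y, vanishes_below m y & `|y| = 1].
Proof.
move=> Zsub Zinf m.
have := infinite_dimensional_vanishes_below Zsub Zinf (m := m).
have [[u [[Zu u0] un0]] _|H] :=
    pselect (exists u, (Z `&` [set u | vanishes_below m u]) u /\ u != 0).
  have [Zy y1] := normalizeZ Zsub Zu un0.
  exists (`|u|^-1 *: u); split=> //.
  by move=> i im; rewrite ellZ u0// mulr0.
case; exists 0%N, (fun _ => 0); apply/seteqP; split=> u /=.
  move=> Zu; exists (fun=> 0) => //; rewrite big_ord0.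
  by apply/esym/eqP; apply: contrapT => /negP un0; apply: H; exists u.
move=> [c _ <-]; rewrite big_ord0; split; last by [].
by have [Z0 _] := Zsub; exact/set_mem.
Qed.

Lemma sum_powR_le_norm u (s : seq nat) : uniq s ->
  \sum_(i <- s) `|u i| `^ p <= `|u| `^ p.
Proof.
move=> us; pose n := (\max_(i <- s) i).+1.
apply: (@le_trans _ _ (\sum_(i <- iota 0 n) `|u i| `^ p)).
  apply: ler_sum_subset => //; first exact: iota_uniq.
  by move=> i is_; rewrite mem_iota/= ltnS leq_bigmax_seq.
rewrite -[iota 0 n]/(index_iota 0 n) big_mkord -ler_powRV//.
  exact: ell_norm_sum.
by rewrite sumr_ge0// => k _; exact: powR_ge0.
Qed.

(** If all partial sums were below [`|u| ^ p - e], so would be the [p]-th power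
    of the norm, their supremum. *)
Lemma sum_powR_approximates u (e : R) : 0 < e ->
  exists m, `|u| `^ p <= \sum_(i <- iota 0 m) `|u i| `^ p + e.
Proof.
move=> e0; apply: contrapT => /forallNP H.
have lt_sum n : \sum_(k < n) `|u k| `^ p < `|u| `^ p - e.
  rewrite ltNge; apply/negP => h; apply: (H n).
  have -> : iota 0 n = index_iota 0 n by rewrite /index_iota subn0.
  by rewrite big_mkord -lerBlDr.
set r := `|u| `^ p - e in lt_sum.
have r0 : 0 < r by apply: le_lt_trans (lt_sum 0%N); rewrite big_ord0.
have rK : (r `^ p^-1) `^ p = r by rewrite -powRrM mulVf ?gt_eqF// powRr1// ltW.
have [|n|w [wu wr]] := @ell_of_bounded R p p_gt1 (r `^ p^-1) u.
- exact: powR_ge0.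
- rewrite ler_powRV ?powR_ge0// ?rK; first exact: ltW.
  by rewrite sumr_ge0// => k _; rewrite powR_ge0.
have {}wu : w = u by exact: ell_inj.
have : `|u| `^ p <= r.
  by rewrite -rK -wu; apply: ge0_ler_powR; rewrite ?nnegrE ?powR_ge0// ltW.
by rewrite leNgt ltrBlDr ltrDl e0.
Qed.

(** The single index [m] serves for the head and for the tail, so that both can
    be used for the same splitting in [hump_increases_norm]. *)
Lemma small_tail u (e : R) : 0 < e -> exists m,
  `|u| `^ p <= \sum_(i <- iota 0 m) `|u i| `^ p + e /\
  forall s : seq nat, uniq s -> {in s, forall i, (m <= i)%N} ->
    \sum_(i <- s) `|u i| `^ p <= e.
Proof.
move=> e0; have [m um] := sum_powR_approximates u e0.
exists m; split=> // s us sm.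
have := sum_powR_le_norm u (uniq_iota_cat us sm); rewrite big_cat/=.
move=> /le_trans/(_ um); lra.
Qed.

Lemma sum_powRD_le u v (s : seq nat) :
  \sum_(i <- s) `|(u + v : ell p_gt1) i| `^ p <=
  2 `^ p * (\sum_(i <- s) `|u i| `^ p + \sum_(i <- s) `|v i| `^ p).
Proof.
by rewrite -big_split mulr_sumr; apply: ler_sum => i _; exact: powRD_le.
Qed.

(** * Gliding humps *)

(** Below [m] the sum agrees with [v], which accounts for [`|v| ^ p] up to [c].
    Beyond [m] it is [y] perturbed by the small tail of [v], and by the crude
    inequality [powRD_le] this accounts for [2 ^ - p] up to errors of size [c].
    Three errors occur (the head of [v], its tail, the truncation of [y]), so
    [2 ^ - p = 5 c] leaves a gain larger than [c]. *)
Lemma hump_increases_norm v y m (c : R) : 2 `^ p * (5 * c) = 1 -> 0 < c ->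
  `|v| `^ p <= \sum_(i <- iota 0 m) `|v i| `^ p + c ->
  (forall s : seq nat, uniq s -> {in s, forall i, (m <= i)%N} ->
    \sum_(i <- s) `|v i| `^ p <= c) ->
  vanishes_below m y -> `|y| = 1 ->
  `|v| `^ p + c <= `|v + y| `^ p.
Proof.
move=> cE c0 head tail y0 y1.
have two_powR_ge1 : 1 <= 2 `^ p :> R.
  by rewrite -[leLHS](powRr0 2) ler_powR// ?ler1n// ltW.
have [M yM] := sum_powR_approximates y c0.
pose s := [seq i <- iota 0 M | (m <= i)%N].
have us : uniq s by rewrite filter_uniq// iota_uniq.
have sm : {in s, forall i, (m <= i)%N}.
  by move=> i; rewrite mem_filter => /andP[].
have ys : 1 <= \sum_(i <- s) `|y i| `^ p + c.
  move: yM; rewrite y1 powR1 => /le_trans; apply; rewrite lerD2r.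
  rewrite big_filter [leRHS]big_mkcond/=; apply: ler_sum => i _.
  case: leqP => // im; rewrite y0// normr0 powR0// gt_eqF//.
have ysum : \sum_(i <- s) `|y i| `^ p <=
    2 `^ p * (\sum_(i <- s) `|(v + y : ell p_gt1) i| `^ p +
              \sum_(i <- s) `|v i| `^ p).
  rewrite -big_split mulr_sumr; apply: ler_sum => i _ /=.
  have -> : y i = (v i + y i) + - v i by rewrite addrAC subrr add0r.
  by rewrite -(normrN (v i)) powRD_le.
have := sum_powR_le_norm (v + y) (uniq_iota_cat us sm); rewrite big_cat/=.
have -> : \sum_(i <- iota 0 m) `|(v + y : ell p_gt1) i| `^ p =
    \sum_(i <- iota 0 m) `|v i| `^ p.
  apply: eq_big_seq => i; rewrite mem_iota add0n => im.
  by rewrite ellD y0 ?addr0.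
have := tail _ us sm.
move: head ys ysum.
set Y := \sum_(i <- s) `|y i| `^ p.
set W := \sum_(i <- s) `|(v + y : ell p_gt1) i| `^ p.
move=> head ys ysum Vc BW.
have : 2 `^ p * (5 * c) <= 2 `^ p * (W + c + c).
  rewrite cE (le_trans ys)// !mulrDr; apply: lerD.
    by rewrite (le_trans ysum)// mulrDr lerD2l ler_wpM2l// powR_ge0.
  by rewrite ler_peMl// ltW.
rewrite ler_pM2l ?powR_gt0// => ?; lra.
Qed.

(** The invariant [P] is what the humps are chosen to preserve; it is used once
    for a bound on the coordinates and once for a bound on the levels. The step
    has to provide a hump beyond every large index, since the index must also
    exceed the one beyond which the tail of [v] is small. *)
Lemma gliding_hump Z (P : ell p_gt1 -> Prop) : submod_closed (mem Z) ->
  P 0 ->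
  (forall v, Z v -> P v -> exists m0, forall m, (m0 <= m)%N ->
     exists y, [/\ Z y, vanishes_below m y, `|y| = 1 & P (v + y)]) ->
  forall C : R, exists v, [/\ Z v, P v & C < `|v|].
Proof.
move=> [Z0 ZD] P0 step C.
pose c : R := (5 * 2 `^ p)^-1.
have c0 : 0 < c by rewrite invr_gt0 mulr_gt0// powR_gt0.
have cE : 2 `^ p * (5 * c) = 1.
  by rewrite mulrCA mulrA /c mulfV// gt_eqF// mulr_gt0// powR_gt0.
have hump n : exists v, [/\ Z v, P v & n%:R * c <= `|v| `^ p].
  elim: n => [|n [v [Zv Pv nv]]].
    by exists 0; split; [exact/set_mem|by []|rewrite mul0r powR_ge0].
  have [m0 H] := step _ Zv Pv; have [m1 [head tail]] := small_tail v c0.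
  have [y [Zy y0 y1 Py]] := H _ (leq_maxl m0 m1).
  exists (v + y); split=> //.
    by rewrite -(scale1r v); apply/set_mem/ZD; exact/mem_set.
  rewrite -natr1 mulrDl mul1r.
  apply: le_trans (hump_increases_norm cE c0 _ _ _ y1).
  - by rewrite lerD2r.
  - exact: head.
  - exact: tail.
  - by move=> i im; apply: y0; rewrite (leq_trans im)// leq_maxr.
have [v [Zv Pv nv]] := hump (Num.bound (`|C| `^ p / c)).
exists v; split=> //; rewrite ltNge; apply/negP => vC.
have : `|v| `^ p <= `|C| `^ p.
  apply: ge0_ler_powR; rewrite ?nnegrE//; first exact: ltW.
  exact: le_trans vC (ler_norm _).
move=> /(le_trans nv); rewrite -ler_pdivlMr// leNgt.
by rewrite (le_lt_trans _ (archi_boundP _))// divr_ge0 ?powR_ge0// ltW.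
Qed.

Lemma small_coordinates u (e : R) : 0 < e ->
  exists m, forall i, (m <= i)%N -> `|u i| <= e.
Proof.
move=> e0; have [m [_ tail]] := small_tail u (powR_gt0 p e0).
exists m => i mi; rewrite leNgt; apply/negP => ei.
have := gt0_ltr_powR p0 (ltW e0) (normr_ge0 (u i)) ei.
rewrite ltNge => /negP; apply.
have := tail [:: i] isT; rewrite big_seq1; apply.
by move=> j; rewrite inE => /eqP ->.
Qed.

(** Where a hump of norm 1 starts, the previous sum already has coordinates at
    most 1, so coordinates stay bounded by 2 while the norm grows. *)
Lemma exists_unit_small_coordinates Z : submod_closed (mem Z) ->
  ~ finite_dimensional Z -> forall (m : nat) (e : R), 0 < e ->
  exists y, [/\ Z y, vanishes_below m y, `|y| = 1 & forall i, `|y i| <= e].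
Proof.
move=> Zsub Zinf m e e0.
have [||v [Zv [v0 v2] ev]] := @gliding_hump Z
  (fun v => vanishes_below m v /\ forall i, `|v i| <= 2) Zsub _ _ (2 / e).
- by split=> i; rewrite ?normr0.
- move=> v Zv [v0 v2]; have [m1 vm1] := small_coordinates v ltr01.
  exists (maxn m m1) => k; rewrite geq_max => /andP[mk m1k].
  have [y [Zy y0 y1]] := exists_unit_vanishing_below Zsub Zinf k.
  exists y; split=> //; split=> i.
    by move=> im; rewrite ellD v0// y0 ?addr0// (leq_trans im).
  have [ik|ki] := ltnP i k; first by rewrite ellD y0// addr0.
  rewrite ellD (le_trans (ler_normD _ _))//.
  have := vm1 i (leq_trans m1k ki); have := ell_norm_coord y i.
  rewrite -[ell_norm y]/`|y| y1; lra.
have vn0 : 0 < `|v| by rewrite (lt_trans _ ev)// divr_gt0.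
have vN0 : v != 0 by rewrite -normr_gt0.
have [Zy y1] := normalizeZ Zsub Zv vN0.
exists (`|v|^-1 *: v); split=> // i.
  by move=> im; rewrite ellZ v0// mulr0.
rewrite ellZ normrM normfV normr_id mulrC ler_pdivrMr// (le_trans (v2 i))//.
by rewrite mulrC -ler_pdivrMr// ltW.
Qed.

(** * Flat humps and the weak norm *)

(** The [p]-th power of the weak quasi-norm is the least such [C]; finite lists
    of indices avoid the rearrangement. *)
Definition level_bounded (C : R) (v : nat -> R) := forall (s : seq nat) (l : R),
  uniq s -> 0 < l -> {in s, forall i, l <= `|v i|} -> (size s)%:R * l `^ p <= C.

Lemma weak_norm_level_bounded (C : R) (v : nat -> R) : 0 <= C ->
  level_bounded C v -> (weak_norm p v <= (C `^ p^-1)%:E)%E.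
Proof.
move=> C0 vC; apply/weak_norm_leP => // s l us sl.
have [l0|l0] := leP l 0.
  by rewrite (le_trans _ (powR_ge0 _ _))// mulr_ge0_le0// powR_ge0.
have -> : l = (l `^ p) `^ p^-1.
  by rewrite -powRrM mulfV ?gt_eqF// powRr1// ltW.
rewrite -powRM ?powR_ge0 ?ler0n//.
apply: ge0_ler_powR; rewrite ?nnegrE ?invr_ge0 ?mulr_ge0 ?powR_ge0//.
- exact: ltW.
- exact: vC.
Qed.

(** Levels above the threshold [e] only see the old vector, and those below it
    are estimated directly, whatever the constant of the old vector: this is why
    the same constant serves at every step. *)
Lemma exists_large_level_bounded Z : submod_closed (mem Z) ->
  ~ finite_dimensional Z -> forall K : R,
  exists v, [/\ Z v, level_bounded (1 + 2 `^ p * 2) v & K < `|v|].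
Proof.
move=> Zsub Zinf; have C0 : 0 <= 1 + 2 `^ p * 2 :> R.
  by rewrite addr_ge0// mulr_ge0// powR_ge0.
apply: gliding_hump => //.
  case=> [|i s] l _ l0 sl; first by rewrite mul0r.
  have := sl i (mem_head _ _); rewrite normr0 => /(lt_le_trans l0).
  by rewrite ltxx.
move=> v Zv vC; have [m1 [_ tail]] := small_tail v ltr01.
(* With this threshold, m1 coordinates contribute at most 1 to lower levels. *)
pose e : R := m1.+1%:R^-1 `^ p^-1.
have e0 : 0 < e by rewrite powR_gt0// invr_gt0 ltr0n.
have eE : e `^ p = m1.+1%:R^-1.
  by rewrite -powRrM mulVf ?gt_eqF// powRr1// invr_ge0.
(* Thirds rather than halves: two of them stay strictly below the threshold. *)
have e3 : 0 < e / 3 by rewrite divr_gt0.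
have [m2 vm2] := small_coordinates v e3.
exists m2 => m m2m.
have [y [Zy y0 y1 ye]] := exists_unit_small_coordinates Zsub Zinf m e3.
exists y; split=> // s l us l0 sl.
have [le|el] := leP l e; last first.
  apply: (vC s l us l0) => i is_; have := sl i is_.
  have [im|mi] := ltnP i m; first by rewrite ellD y0// addr0.
  have := vm2 i (leq_trans m2m mi); have := ye i.
  have := ler_normD (v i) (y i); rewrite ellD; lra.
pose s1 := [seq i <- s | (i < m1)%N]; pose s2 := [seq i <- s | (m1 <= i)%N].
have us2 : uniq s2 by rewrite filter_uniq.
have -> : size s = (size s1 + size s2)%N.
  rewrite /s1 /s2 !size_filter -(count_predC (fun i => i < m1)%N).
  by congr (_ + _)%N; apply: eq_count => i /=; rewrite -leqNgt.
rewrite natrD mulrDl; apply: lerD.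
  have s1m : (size s1 <= m1.+1)%N.
    apply: (@leq_trans m1) => //; rewrite -[leqRHS](size_iota 0 m1).
    apply: uniq_leq_size; first exact: filter_uniq.
    by move=> i; rewrite mem_filter mem_iota => /andP[].
  apply: (@le_trans _ _ (m1.+1%:R * e `^ p)); last by rewrite eE mulfV.
  apply: ler_pM; rewrite ?powR_ge0 ?ler_nat//.
  by apply: ge0_ler_powR; rewrite ?nnegrE// ltW.
have s2l : {in s2, forall i, l <= `|(v + y : ell p_gt1) i|}.
  by move=> i; rewrite mem_filter => /andP[_ /sl].
apply: le_trans (level_size_le_sum p0 (ltW l0) s2l) _.
apply: le_trans (sum_powRD_le _ _ _) _.
rewrite ler_wpM2l ?powR_ge0// [leRHS](_ : 2 = 1 + 1 :> R)//; apply: lerD.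
  by apply: tail => // i; rewrite mem_filter => /andP[].
by rewrite (le_trans (sum_powR_le_norm _ us2))// y1 powR1.
Qed.

End SequencesInEll.

Theorem theorem3p1 (R : realType) (p : R) (p_gt1 : 1 < p)
    (N : equivalent_norm p_gt1) : strictly_singular (embedding N).
Proof.
have [c [C [_ C0 NE]]] := enorm_equiv N.
have bound (u : ell p_gt1) (r : R) :
    (weak_norm p u <= r%:E)%E -> `|embedding N u| <= C * r.
  move=> ur; have /andP[_ NC] := NE (embedding N u).
  rewrite -[leLHS]/(N (embedding N u)) -lee_fin; apply: le_trans NC _.
  by rewrite EFinM lee_wpmul2l// lee_fin ltW.
split.
  apply/linear_bounded_continuous/linear_boundedP; near=> r => u.
  apply: le_trans (bound u _ (weak_norm_le_ell u)) _.
  by rewrite ler_wpM2r//; near: r; exact: nbhs_pinfty_ge.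
move=> Z Zsub _ Zinf /(isomorphic_on_bounded_below Zsub)[K K0 ZK].
pose M : R := 1 + 2 `^ p * 2.
have M0 : 0 <= M by rewrite addr_ge0// mulr_ge0// powR_ge0.
have [v [Zv vM]] :=
  exists_large_level_bounded Zsub Zinf (K * (C * M `^ p^-1)).
rewrite ltNge => /negP; apply; apply: le_trans (ZK v Zv) _.
rewrite ler_pM2l//; apply: bound.
exact: weak_norm_level_bounded.
Unshelve. all: by end_near. Qed.
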